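(* Let $A$ be a nonempty finite set of positive integers and let $i \ge 0$, $j \ge 1$ be integers. There exists a bijection $\mathcal{L}_{i,j}(A) \to \mathcal{L}_{i+1,j-1}(A)$ that preserves the weight $\omega$, i.e. if $(T,\phi)$ is mapped to $(T',\phi')$ then $\omega(T,\phi) = \omega(T',\phi')$.
   Context: A labelled tree $T$ with vertex labels given by $A$ is a tree (acyclic connected graph) with vertex set $A$; it is rooted at the vertex $\min(A)$, and is unordered. For a non-root vertex $w$, its father $f_T(w)$ is the neighbour of $w$ on the unique path from $w$ to the root. A non-root vertex $w$ is increasing if $f_T(w) < w$ and decreasing otherwise; the root is neither increasing nor decreasing. The hook $h_T(w)$ is the set of vertices $u$ such that $w$ lies on the unique path from the root to $u$ (so $w \in h_T(w)$). For integers $i,j \ge 0$, $\mathcal{L}_{i,j}(A)$ is the set of pairs $(T,\phi)$ where $T$ is a labelled tree with vertex labels given by $A$ (rooted at $\min(A)$), $\phi$ is a function from the set of increasing vertices of $T$ to $A$, and: (1) for any increasing vertex $v$ of $T$, $\phi(v) \in h_T(v)$ and $\phi(v) \ge v$; (2) if $v$ is an increasing vertex of $T$ and $\phi(v) \ne v$, then every vertex on the unique path from $v$ to the root (not including the root) is increasing; (3) if $v$ is a decreasing vertex of $T$ and $u$ is an increasing vertex with $\phi(u) \neq u$, then $u < v$; (4) $T$ has exactly $i$ decreasing vertices; (5) $T$ has exactly $j$ increasing vertices $v$ with $\phi(v) \neq v$. Let $x_a$ ($a \in A$) and $y_{a,b}$ ($a,b \in A$, $a \le b$) be commuting indeterminates.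 The weight of $(T,\phi)$ is the monomial $$\omega(T,\phi) = \prod_{w \text{ increasing in } T} x_{f_T(w)}\, y_{w,\phi(w)} \prod_{w \text{ decreasing in } T} x_w\, y_{w,f_T(w)}.$$ *)

(* Defs.v *)
From mathcomp Require Import all_boot.
From mathcomp Require Import finmap.
From mathcomp.multinomials Require Import monalg.

Set Implicit Arguments.
Unset Strict Implicit.
Unset Printing Implicit Defensive.

(* A graph on V is its set of edges, an edge being a two-element subset of V. *)
Section Graphs.
Variables (V : finType) (E : {set {set V}}).

Definition simple_graph : bool := [forall e in E, #|e| == 2].

Definition adj : rel V := [rel u v | [set u; v] \in E].

Definition connected : bool := [forall u, forall v, connect adj u v].

(* A repetition-free sequence of vertices has length at most #|V|, so bounded
   sequences cover all cycles (and all simple paths below).  Since adj is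
   symmetric, ucycleb also accepts closed walks of length at most 2: these are
   not cycles of the graph. *)
Definition acyclic : bool :=
  [forall c : #|V|.-bseq V, ucycleb adj c ==> (size c <= 2)].

Definition is_tree : bool := [&& simple_graph, connected & acyclic].

(* u :: p is a path without repeated vertices from u to v. *)
Definition simple_path (u v : V) (p : seq V) : bool :=
  [&& path adj u p, last u p == v & uniq (u :: p)].

End Graphs.

Section LabelledTrees.
Variable A : {fset nat}.

Local Notation V := (fset_sub_type A).

Definition is_root (v : V) : bool := [forall u : V, val v <= val u].

Section Tree.
Variable T : {set {set V}}.

(* The vertices following w on the path from w to the root, so that
   w :: to_root w is the full path.  In a tree this path exists and is unique;
   the default is never used. *)
Definition to_root (w : V) : seq V :=
  if [pick p : #|{: V}|.-bseq V | [exists r, is_root r && simple_path T w r p]]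
    is Some p then p else [::].

(* Meaningful for non-root w only; the root is its own father by default. *)
Definition father (w : V) : V := head w (to_root w).

Definition increasing (w : V) : bool :=
  ~~ is_root w && (val (father w) < val w).

Definition decreasing (w : V) : bool :=
  ~~ is_root w && ~~ (val (father w) < val w).

Definition hook (w : V) : {set V} := [set u | w \in u :: to_root u].

End Tree.

(* A pair (T, phi); phi is a partial function, and its domain is required to
   be the set of increasing vertices of T in the definition of calL. *)
Definition tree_fun : finType := ({set {set V}} * {ffun V -> option V})%type.

Definition moved (p : tree_fun) (v : V) : bool :=
  increasing p.1 v && (p.2 v != Some v).

Definition calL (i j : nat) : {set tree_fun} :=
  [set p : tree_fun | let: (T, phi) := p in
    [&& is_tree T,
        [forall v, (phi v : bool) == increasing T v],
        [forall v, forall b, (increasing T v && (phi v == Some b)) ==>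
           (b \in hook T v) && (val v <= val b)],
        [forall v, moved p v ==>
           all (fun u => ~~ is_root u ==> increasing T u) (v :: to_root T v)],
        [forall v, forall u, (decreasing T v && moved p u) ==>
           (val u < val v)],
        #|[set v | decreasing T v]| == i
      & #|[set v | moved p v]| == j]].

(* Indeterminates: inl a is x_a and inr (a, b) is y_{a,b}.  The y_{a,b} with
   b < a are also present, but occur in no weight of an element of calL. *)
Definition indet : choiceType := (V + V * V)%type.

Definition x_ (a : V) : {cmonom indet} := ucm (inl a : indet).
Definition y_ (a b : V) : {cmonom indet} := ucm (inr (a, b) : indet).

(* On calL, phi w is Some _ for every increasing w, so the default of odflt is
   irrelevant. *)
Definition weight (p : tree_fun) : {cmonom indet} :=
  let: (T, phi) := p in
  mmul
    (\big[mmul/mone]_(w | increasing T w)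
        mmul (x_ (father T w)) (y_ w (odflt w (phi w))))
    (\big[mmul/mone]_(w | decreasing T w)
        mmul (x_ w) (y_ w (father T w))).

End LabelledTrees.

(* Main.v *)
Require Import Defs.
From mathcomp Require Import all_boot.
From mathcomp Require Import finmap.
From mathcomp.multinomials Require Import monalg.

Set Implicit Arguments.
Unset Strict Implicit.
Unset Printing Implicit Defensive.

(* Let v be the largest vertex with phi(v) <> v, p its father, b = phi(v), and
   u the child of v towards b.  All vertices on the way from v to b exceed v:
   decreasing ones by condition (3), increasing ones since they exceed their
   father.  Making u a child of p and v a child of b therefore keeps u
   increasing and turns v into a decreasing vertex; it exchanges the factors
   x_p and x_v contributed by v and u, and y_{v,b} now comes from the edge of
   the decreasing vertex v.  Conversely v is the smallest decreasing vertex of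
   the new tree, b its father, and p the first vertex below v on the way from
   b to the root. *)

Lemma uniq_size_card (V : finType) (s : seq V) : uniq s -> size s <= #|V|.
Proof. by move/card_uniqP<-; apply: max_card. Qed.

(** For the weights: [a] and [c] are the x-factors of [v] and [u], which change places, while the
    y-factors [b] and [d] stay. *)
Lemma mulm_swap (M : conomType) (a b c d : M) :
  mmul (mmul a b) (mmul c d) = mmul (mmul c b) (mmul a d).
Proof.
rewrite !mulmA; congr (mmul _ _).
by rewrite mulmC [mmul a b]mulmC mulmA.
Qed.

(** * Existence and uniqueness of simple paths *)

Section GraphTheory.
Variables (V : finType) (E : {set {set V}}).

Lemma adj_sym : symmetric (adj E).
Proof. by move=> u v; rewrite /adj /= setUC. Qed.

Lemma simple_path_exists u v : connected E -> exists p, simple_path E u v p.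
Proof.
move=> /forallP/(_ u)/forallP/(_ v)/connectP[p pth ->].
case/shortenP: pth => q pth uq _.
by exists q; rewrite /simple_path pth eqxx.
Qed.

Lemma simple_path_unique u v p q : acyclic E ->
  simple_path E u v p -> simple_path E u v q -> p = q.
Proof.
move=> acE; elim: p u q => [|a p IHp] u [|b q] //=.
- move=> /and3P[_ /eqP <- _] /and3P[_ /eqP /= lastq /= /andP[uNq _]].
  by rewrite -lastq mem_last in uNq.
- move=> /and3P[_ /eqP /= lastp /= /andP[uNp _]] /and3P[_ /eqP /= lastq _].
  by rewrite lastq -lastp mem_last in uNp.
move=> /and3P[/= /andP[ua pthp] lastp /andP[uNp uniqp]].
move=> /and3P[/= /andP[ub pthq] lastq /andP[uNq uniqq]].
have [eqab|neqab] := eqVneq a b.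
  rewrite -eqab in pthq lastq uniqq *.
  by congr cons; apply: (IHp a); apply/and3P.
(* Two different first steps from u close up to a cycle through u, because
   the rest of both paths avoids u. *)
pose e' := [rel x y | [&& adj E x y, x != u & y != u]].
have e'_sym : symmetric e' by move=> x y; rewrite /= adj_sym [(x != u) && _]andbC.
have conn c s : u \notin c :: s -> path (adj E) c s -> connect e' c (last c s).
  move=> uNs pth; apply/connectP; exists s => //.
  apply: (@sub_in_path _ (predC1 u) (adj E) e') pth.
    by move=> x y; rewrite /e' /= !inE => -> -> ->.
  by apply/allP => x xs; apply: contraNneq uNs => <-.
have := conn a p uNp pthp; have := conn b q uNq pthq.
rewrite (eqP lastp) (eqP lastq) (sym_connect_sym e'_sym) => vb av.
have /connectP[s pths lasts] := connect_trans av vb.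
case/shortenP: pths lasts => {}s pths uniqs _ lasts.
(* Every step of [s] is taken along [e'], which avoids [u]. *)
have uNs : u \notin a :: s.
  have: a != u by apply: contraNneq uNp => ->; rewrite mem_head.
  rewrite inE eq_sym negb_or => ->/=.
  elim: s a pths {uniqs lasts uNp neqab ua pthp lastp uniqp av} => //= x s IHs a.
  case/andP=> /and3P[_ _ xu] /IHs; rewrite inE negb_or => ->.
  by rewrite eq_sym xu.
have uniqc : uniq [:: u, a & s] by rewrite cons_uniq uNs.
have /forallP/(_ (Bseq (uniq_size_card uniqc)))/implyP := acE.
rewrite /ucycleb uniqc andbT.
have -> : cycle (adj E) (Bseq (uniq_size_card uniqc)).
  rewrite /= ua rcons_path -lasts adj_sym ub andbT.
  by apply: sub_path pths => x y /and3P[].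
(* The cycle [u, a, s] has size at most 2 only if [s] is empty, and then [a] is already its last
   vertex [b]. *)
move=> /(_ isT); rewrite /= !ltnS leqn0 size_eq0 => /eqP s0.
by rewrite lasts s0 eqxx in neqab.
Qed.

End GraphTheory.

(** * Orbits of a self-map *)

Lemma fconnect_closed (V : finType) (f : V -> V) (P : V -> Prop) x y :
  (forall z, P z -> P (f z)) -> P x -> fconnect f x y -> P y.
Proof.
move=> Pf Px /iter_findex <-.
by elim: (findex f x y) => //= n; apply: Pf.
Qed.

Lemma fconnect_comparable (V : finType) (f : V -> V) x y z :
  fconnect f x y -> fconnect f x z -> fconnect f y z || fconnect f z y.
Proof.
move=> /iter_findex <- /iter_findex <-.
have iter_le m n : m <= n -> fconnect f (iter m f x) (iter n f x).
  by move=> /subnK <-; rewrite iterD fconnect_iter.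
by have [/iter_le->//|/ltnW/iter_le->] := leqP (findex f x y) (findex f x z); rewrite orbT.
Qed.

(** An orbit segment survives a change of the map at vertices off the segment; the value at the end
    [y] is free. *)
Lemma fconnect_agree (V : finType) (f g : V -> V) x y :
  (forall z, fconnect f x z -> fconnect f z y -> z != y -> g z = f z) ->
  fconnect f x y -> fconnect g x y.
Proof.
move=> agree /iter_findex; move: (findex f x y) => n; elim: n x agree => [|n IHn] x agree.
  by move=> /= ->.
have [->//|xy] := eqVneq x y; rewrite iterSr => fxy.
have fcxy : fconnect f (f x) y by rewrite -fxy fconnect_iter.
have fx z : fconnect f (f x) z -> fconnect f x z.
  by move=> H; rewrite fconnect_eqVf H orbT.
rewrite fconnect_eqVf agree ?IHn ?orbT //; last exact: fx.
by move=> z /fx; apply: agree.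
Qed.

Lemma fconnect_last (V : finType) (f : V -> V) x y :
  fconnect f x y -> x != y -> exists2 z, fconnect f x z & f z = y.
Proof.
move=> /iter_findex <-; case: (findex f x y) => [|n] /=; first by rewrite eqxx.
by move=> _; exists (iter n f x); rewrite ?fconnect_iter.
Qed.

(** A discrete intermediate value argument, which locates [u] when the construction is inverted. *)
Lemma fconnect_crossing (V : finType) (f : V -> V) (P : pred V) x y :
  fconnect f x y -> ~~ P x -> P y ->
  exists z, [/\ fconnect f x z, ~~ P z & P (f z)].
Proof.
move=> /iter_findex <-; elim: (findex f x y) => [|n IHn] /= nPx.
  by rewrite (negPf nPx).
have [Pn _|nPn Pfn] := boolP (P (iter n f x)); first exact: IHn.
by exists (iter n f x); rewrite fconnect_iter.
Qed.

(** * Rooted trees as father functions *)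

Section FatherFunctions.
Variables (V : finType) (r : V).

(** Fixing the root makes the father function total, so that ancestry is [fconnect] and a tree can
    be rewired by changing values of a function. *)
Definition rooted (f : V -> V) := f r = r /\ forall w, fconnect f w r.

Definition edges (f : V -> V) : {set {set V}} :=
  [set [set w; f w] | w in [set w | w != r]].

Section Rooted.
Variable f : V -> V.
Hypothesis f_rooted : rooted f.

(** The distance to the root, which serves as the measure for inductions along ways to the root. *)
Definition depth w := findex f w r.

Lemma depth_father w : w != r -> depth w = (depth (f w)).+1.
Proof. by rewrite eq_sym; apply: fconnect_findex; case: f_rooted. Qed.

Lemma depth_le x y : fconnect f x y -> depth y <= depth x.
Proof.
apply: (@fconnect_closed _ f (fun y => depth y <= depth x)) => // z.
apply: leq_trans; have [->|zr] := eqVneq z r; first by case: f_rooted => ->.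
by rewrite [depth z]depth_father.
Qed.

Lemma fconnect_root w : fconnect f r w -> w = r.
Proof.
apply: (@fconnect_closed _ f (fun w => w = r)) => // _ ->.
by case: f_rooted.
Qed.

Lemma depth_lt x y : fconnect f x y -> x != y -> depth y < depth x.
Proof.
move=> xy neq; have xr : x != r.
  by apply: contraNneq neq => xr; move: xy; rewrite xr => /fconnect_root ->.
rewrite (depth_father xr) ltnS; apply: depth_le.
by move: xy; rewrite fconnect_eqVf (negPf neq).
Qed.

Lemma fconnect_anti x y : fconnect f x y -> fconnect f y x -> x = y.
Proof.
move=> xy yx; apply/eqP; apply/negPn/negP => neq.
have := ltn_trans (depth_lt xy neq) (depth_lt yx _).
by rewrite ltnn eq_sym => /(_ neq).
Qed.

Lemma father_neq w : w != r -> f w != w.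
Proof.
by move=> wr; apply/eqP => fw; have := depth_father wr; rewrite fw => /n_Sn.
Qed.

Lemma adj_father w : w != r -> adj (edges f) w (f w).
Proof. by move=> wr; apply/imsetP; exists w; rewrite ?inE. Qed.

Lemma adjP x y : adj (edges f) x y -> (y = f x /\ x != r) \/ (x = f y /\ y != r).
Proof.
case/imsetP=> w; rewrite inE => wr exy.
have fww := father_neq wr.
have : x \in [set w; f w] by rewrite -exy !inE eqxx.
have : y \in [set w; f w] by rewrite -exy !inE eqxx orbT.
have : f w \in [set x; y] by rewrite exy !inE eqxx orbT.
have : w \in [set x; y] by rewrite exy !inE eqxx.
rewrite !inE => + + /orP[]/eqP yw /orP[]/eqP xw.
- by rewrite xw yw (negPf fww) => _ /=.
- by right; rewrite xw yw.
- by left; rewrite xw yw.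
- by rewrite xw yw eq_sym (negPf fww).
Qed.

Lemma edges_simple : simple_graph (edges f).
Proof.
apply/forallP => e; apply/implyP => /imsetP[w]; rewrite inE => wr ->.
by rewrite cards2 [w == _]eq_sym father_neq.
Qed.

Lemma edges_connected : connected (edges f).
Proof.
have sub w : connect (adj (edges f)) w r.
  apply: (connect_sub (e := frel f)) (proj2 f_rooted w) => x _ /eqP <-.
  have [->|xr] := eqVneq x r; first by case: f_rooted => ->.
  exact/connect1/adj_father.
apply/forallP => u; apply/forallP => v; apply: connect_trans (sub u) _.
by rewrite (sym_connect_sym (@adj_sym _ _)).
Qed.

(* Both neighbours of a deepest vertex of a cycle are its father. *)
Lemma edges_acyclic : acyclic (edges f).
Proof.
apply/forallP => -[c /= _]; apply/implyP => /andP[cyc uc].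
case: c cyc uc => // x0 c0; set c := x0 :: c0 => cyc uc.
have x0c : x0 \in c by rewrite mem_head.
case: (arg_maxnP depth x0c) => x xc xmax.
have [i c' rotc] := rot_to xc.
have xmax' y : y \in x :: c' -> depth y <= depth x.
  by rewrite -rotc mem_rot; apply: xmax.
rewrite -(size_rot i); rewrite -(rot_cycle i) in cyc; rewrite -(rot_uniq i) in uc.
move: uc cyc; rewrite rotc => uc.
have nbr y : y \in x :: c' -> adj (edges f) x y -> y = f x.
  move=> yc /adjP[[-> //]|[xy yr]].
  by have := xmax' y yc; rewrite (depth_father yr) xy ltnn.
case: c' xmax' nbr uc {rotc} => //= y c' xmax' nbr.
case/and3P=> _ yNc _ /andP[xy]; rewrite rcons_path adj_sym => /andP[_ xz].
case/lastP: c' xmax' nbr yNc xz => //= s z _ nbr.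
rewrite last_rcons => yNc xz.
have yE : y = f x by apply: nbr xy; rewrite !inE eqxx orbT.
have zE : z = f x by apply: nbr xz; rewrite !inE mem_rcons mem_head !orbT.
by rewrite yE zE mem_rcons mem_head in yNc.
Qed.

Lemma edges_tree : is_tree (edges f).
Proof. by rewrite /is_tree edges_simple edges_connected edges_acyclic. Qed.

End Rooted.

(** Induction on depth: if the edge from [w] to [f w] were oriented the other way in [g], then
    [w = g (f w) = f (f w)], against the depths. *)
Lemma edges_inj f g : rooted f -> rooted g -> edges f = edges g -> f =1 g.
Proof.
move=> rf rg eE w.
have [n] := ubnP (depth f w); elim: n w => // n IHn w; rewrite ltnS => dw.
have [->|wr] := eqVneq w r; first by case: rf rg => -> _ [-> _].
have := adj_father f wr; rewrite eE => /(adjP rg)[[]//|[wE fwr]].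
have dfw := depth_father rf wr.
have := depth_father rf fwr; rewrite (IHn (f w)) -?dfw // -wE dfw.
by move/eqP; rewrite -addn2 -[X in X == _]addn0 eqn_add2l.
Qed.

(** * Ancestry after changing the fathers of two vertices *)

Section Rewiring.
Variables (f g : V -> V) (v b u : V).
Hypothesis f_rooted : rooted f.
Hypotheses (vr : v != r) (ur : u != r).
Hypothesis fg : forall w, w != u -> w != v -> g w = f w.

(** A way through [u] now skips [v], and a way starting at [v] makes a detour through [b] and [u]
    before it reaches [f v]. Hence only [v] can be lost as an ancestor. *)
Lemma fconnect_cut : f u = v -> fconnect f b u -> g u = f v -> g v = b ->
  fconnect g b u /\
  (forall c w, fconnect f c w -> w != v -> fconnect g c w).
Proof.
move=> fu bu gu gv.
have uv : u != v by rewrite -fu eq_sym father_neq.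
have gbu : fconnect g b u.
  (* The way from [b] to [u] misses [v]: otherwise [u] and its father [v] would be ancestors of each
     other. *)
  apply: fconnect_agree bu => x _ xu neq; rewrite fg //.
  apply: contraNneq uv => xv; rewrite xv in xu.
  by rewrite (fconnect_anti f_rooted xu) // -fu fconnect1.
split=> // c w; have [n] := ubnP (depth f c); elim: n c => // n IHn c.
rewrite ltnS => dc cw wv.
have [->//|neq] := eqVneq c w.
have cr : c != r.
  by apply: contraNneq neq => cr; rewrite cr in cw; rewrite (fconnect_root f_rooted cw) cr.
move: cw; rewrite fconnect_eqVf (negPf neq) /= => fcw.
have dfc := depth_father f_rooted cr; have dfv := depth_father f_rooted vr.
have [cv|cv] := eqVneq c v.
  rewrite cv in fcw dfc dc; rewrite cv fconnect_eqVf gv (connect_trans gbu) ?orbT //.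
  rewrite fconnect_eqVf gu IHn ?orbT //.
  by rewrite -dfc.
have [cu|cu] := eqVneq c u.
  rewrite cu fu fconnect_eqVf eq_sym (negPf wv) /= in fcw.
  rewrite cu fu dfv in dfc dc; rewrite cu fconnect_eqVf gu IHn ?orbT //.
  by rewrite dfc in dc; apply: leq_trans dc.
by rewrite fconnect_eqVf fg // IHn ?orbT // -dfc.
Qed.

(** The inverse change: a way through [u] gains the vertex [v], and a way through [v] loses the
    stretch from [b] to [u]. The vertices of that stretch are those excluded by
    [~~ fconnect f w u]. *)
Lemma fconnect_splice : f v = b -> fconnect f b u -> g u = v -> g v = f u ->
  fconnect g b u /\
  (forall c w, fconnect f c w -> ~~ fconnect f w u -> fconnect g c w).
Proof.
move=> fv bu gu gv.
have vb : fconnect f v b by rewrite -fv fconnect1.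
split.
  apply: fconnect_agree bu => x bx _ neq; rewrite fg //.
  apply/eqP => xv; rewrite xv in bx.
  by have := father_neq f_rooted vr; rewrite fv (fconnect_anti f_rooted bx vb) eqxx.
move=> c w; have [n] := ubnP (depth f c); elim: n c => // n IHn c.
rewrite ltnS => dc cw wNu.
have [->//|neq] := eqVneq c w.
have cr : c != r.
  by apply: contraNneq neq => cr; rewrite cr in cw; rewrite (fconnect_root f_rooted cw) cr.
move: cw; rewrite fconnect_eqVf (negPf neq) /= => fcw.
have dfc := depth_father f_rooted cr.
have [cu|cu] := eqVneq c u.
  rewrite cu in fcw dfc dc.
  rewrite cu fconnect_eqVf gu fconnect_eqVf gv IHn ?orbT //.
  by rewrite -dfc.
have [cv|cv] := eqVneq c v; last by rewrite fconnect_eqVf fg // IHn ?orbT // -dfc.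
rewrite cv in fcw dc *; rewrite fv in fcw.
(* Both [u] and [w] lie on the way from [b], and [w] does not come before [u]. *)
have uw : fconnect f u w.
  by have := fconnect_comparable bu fcw; rewrite (negPf wNu) orbF.
rewrite fconnect_eqVf (negPf (_ : u != w)) in uw; last first.
  by apply: contraNneq wNu => <-.
rewrite fconnect_eqVf gv IHn ?orbT //.
rewrite -(depth_father f_rooted ur); apply: leq_trans dc.
exact/(depth_le f_rooted)/(connect_trans vb).
Qed.

End Rewiring.

End FatherFunctions.

(** * Labelled trees and their father functions *)

Section LabelledTrees.
Variable A : {fset nat}.
Local Notation V := (fset_sub_type A).
Variable r : V.
Hypothesis r_root : is_root r.
Implicit Types (T : {set {set V}}) (phi : {ffun V -> option V}).

Lemma root_le (w : V) : val r <= val w.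
Proof. by move: r_root => /forallP. Qed.

Lemma is_rootE w : is_root w = (w == r).
Proof.
apply/idP/eqP => [/forallP/(_ r) wr|->//].
by apply/val_inj/eqP; rewrite eqn_leq wr root_le.
Qed.

Lemma lt_neq_root (w v : V) : val w < val v -> v != r.
Proof. by apply: contraTneq => ->; rewrite -leqNgt root_le. Qed.

Section Tree.
Variable T : {set {set V}}.
Hypothesis T_tree : is_tree T.

(** A simple path is short enough for the bounded sequences searched by [to_root], so the default
    value never occurs. *)
Lemma to_rootP w : simple_path T w r (to_root T w).
Proof.
case/and3P: T_tree => _ T_conn _; have [p wp] := simple_path_exists w r T_conn.
rewrite /to_root; case: pickP => [q /existsP[s]|/(_ (Bseq _)) none].
  by rewrite is_rootE => /andP[/eqP->].
have sz : size p <= #|{: V}|.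
  by apply: uniq_size_card; case/and3P: wp => _ _ /andP[].
by have /existsP[] := none p sz; exists r; rewrite r_root.
Qed.

Lemma to_root_eq w p : simple_path T w r p -> to_root T w = p.
Proof.
by apply: simple_path_unique (to_rootP w); case/and3P: T_tree.
Qed.

Lemma to_root_root : to_root T r = [::].
Proof. by apply: to_root_eq; rewrite /simple_path /= eqxx. Qed.

Lemma to_root_father w :
  w != r -> to_root T w = father T w :: to_root T (father T w).
Proof.
rewrite /father; have := to_rootP w.
case: (to_root T w) => [|a p] /and3P[/= wp lastp uniqp] wr.
  by rewrite (negPf wr) in lastp.
congr cons; apply/esym/to_root_eq; apply/and3P; split=> //.
  by case/andP: wp.
by case/andP: uniqp.
Qed.

Lemma father_root : father T r = r.
Proof. by rewrite /father to_root_root. Qed.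

(** Turns the conditions on paths and hooks into statements about orbits of [father T]. *)
Lemma mem_to_root w u : (u \in w :: to_root T w) = fconnect (father T) w u.
Proof.
have [n] := ubnP (size (to_root T w)); elim: n w => // n IHn w.
have [->|wr] := eqVneq w r.
  move=> _; rewrite to_root_root inE; apply/eqP/idP => [->//|].
  apply: (@fconnect_closed _ _ (fun u => u = r)) => // _ ->.
  exact: father_root.
rewrite to_root_father // => sz.
by rewrite in_cons IHn // [u == w]eq_sym -fconnect_eqVf.
Qed.

Lemma father_rooted : rooted r (father T).
Proof.
split=> [|w]; first exact: father_root.
rewrite -mem_to_root; case/and3P: (to_rootP w) => _ /eqP {1}<- _.
exact: mem_last.
Qed.

Lemma adj_to_father w : w != r -> adj T w (father T w).
Proof.
move=> wr; case/and3P: (to_rootP w); rewrite to_root_father //.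
by case/andP.
Qed.

(** Of two adjacent vertices one, say [y], is off the path from the other, [x], to the root.
    Prefixing that path with [y] gives the path of [y], so [x] is the father of [y]. *)
Lemma edges_father : edges r (father T) = T.
Proof.
apply/eqP; rewrite eqEsubset; apply/andP; split; apply/subsetP => e.
  by case/imsetP => w; rewrite inE => /adj_to_father ? ->.
move=> eT; case/and3P: T_tree => /forall_inP/(_ e eT)/cards2P[u [v [uv eE]]] _ _.
rewrite eE in eT *.
suff adjE x y : adj T x y -> x != y -> ~~ fconnect (father T) x y ->
    adj (edges r (father T)) x y.
  have [uv'|] := boolP (fconnect (father T) u v); last exact: adjE.
  rewrite setUC; apply: adjE; rewrite // 1?eq_sym //.
    by rewrite adj_sym.
  by apply: contraNN uv => vu; rewrite (fconnect_anti father_rooted uv' vu).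
move=> xy neq; rewrite -mem_to_root => yNx.
have -> : x = father T y.
  rewrite /father (@to_root_eq y (x :: to_root T x)) //.
  case/and3P: (to_rootP x) => px lx ux; apply/and3P; split=> //=.
    by rewrite adj_sym xy.
  by rewrite yNx.
rewrite adj_sym; apply: adj_father; apply: contraNneq yNx => ->.
by rewrite mem_to_root; case: father_rooted.
Qed.
End Tree.
(** Together with [edges_father] this identifies trees on [A] with rooted father functions. *)
Lemma father_edges f : rooted r f -> father (edges r f) =1 f.
Proof.
move=> rf; have T_tree := edges_tree rf.
exact: edges_inj (father_rooted T_tree) rf (edges_father T_tree).
Qed.

(** * The conditions on [(T, phi)] in terms of fathers *)

Lemma increasingE T w : increasing T w = (w != r) && (val (father T w) < val w).
Proof. by rewrite /increasing is_rootE. Qed.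

Lemma decreasingE T w : decreasing T w = (w != r) && ~~ increasing T w.
Proof. by rewrite /decreasing increasingE is_rootE; case: (w == r). Qed.

Lemma increasing_father T w : increasing T w -> val (father T w) < val w.
Proof. by rewrite increasingE => /andP[]. Qed.

Lemma increasing_decreasing T w : increasing T w -> ~~ decreasing T w.
Proof. by rewrite decreasingE => ->; rewrite andbF. Qed.

(** Conditions (1) to (3) with paths read as orbits of the father function. The counts (4) and (5)
    are kept apart because a rewiring changes them. *)
Record labelled T phi : Prop := Labelled {
  lab_tree : is_tree T;
  lab_dom : forall v, (phi v : bool) = increasing T v;
  lab_hook : forall v b, phi v = Some b ->
    fconnect (father T) b v /\ val v <= val b;
  lab_moved : forall v x, moved (T, phi) v -> fconnect (father T) v x ->
    x != r -> increasing T x;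
  lab_decreasing : forall v u, decreasing T v -> moved (T, phi) u ->
    val u < val v
}.

Lemma calLP T phi i j :
  reflect [/\ labelled T phi, #|[set v | decreasing T v]| = i &
              #|[set v | moved (T, phi) v]| = j]
          ((T, phi) \in calL A i j).
Proof.
rewrite inE; apply: (iffP and5P) => [[T_tree dom hk mv /and3P[dc /eqP di /eqP mj]]|].
  split=> //; split=> //.
  - by move=> v; apply/eqP/(forallP dom).
  - move=> v b phiv; have /forallP/(_ b)/implyP := forallP hk v.
    rewrite phiv eqxx -(eqP (forallP dom v)) phiv inE.
    by rewrite (mem_to_root T_tree) => /(_ isT)/andP[].
  - move=> v x /(implyP (forallP mv v))/allP/(_ x).
    by rewrite (mem_to_root T_tree) is_rootE => inc /inc/implyP.
  move=> v u dv mu; have /forallP/(_ u)/implyP := forallP dc v.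
  by rewrite dv mu => /(_ isT).
case=> -[T_tree dom hk mv dc] di mj; split=> //.
- by apply/forallP => v; rewrite dom.
- apply/forallP => v; apply/forallP => b; apply/implyP => /andP[_ /eqP/hk[bv ->]].
  by rewrite inE (mem_to_root T_tree) bv.
- apply/forallP => v; apply/implyP => mvv; apply/allP => x.
  by rewrite (mem_to_root T_tree) is_rootE => vx; apply/implyP; apply: mv vx.
apply/and3P; split; [|exact/eqP|exact/eqP].
by apply/forallP => v; apply/forallP => u; apply/implyP => /andP[/dc dv /dv].
Qed.

(** A relation rather than a map, so that counts and weights are compared once for both directions
    of the bijection. Extremality of [v] is not part of it: it is stated among the moved vertices of
    [T] in one direction and among the decreasing vertices of [T'] in the other. *)
Record rewiring T phi T' phi' (v b u : V) : Prop := Rewiring {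
  rew_u : father T u = v;
  rew_u' : father T' u = father T v;
  rew_v' : father T' v = b;
  rew_father : forall w, w != u -> w != v -> father T' w = father T w;
  rew_phi : phi v = Some b;
  rew_phi' : phi' v = None;
  rew_phi_other : forall w, w != v -> phi' w = phi w;
  rew_lt_father : val (father T v) < val v;
  rew_lt_u : val v < val u;
  rew_lt_b : val v < val b;
  rew_conn : fconnect (father T) b u;
  rew_conn' : fconnect (father T') b u
}.

(** * Effect of a rewiring on the conditions and the counts *)

Section Rewiring.
Variables (T T' : {set {set V}}) (phi phi' : {ffun V -> option V}) (v b u : V).
Hypothesis rew : rewiring T phi T' phi' v b u.

Let vr : v != r. Proof. exact: lt_neq_root (rew_lt_father rew). Qed.
Let ur : u != r. Proof. exact: lt_neq_root (rew_lt_u rew). Qed.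

Lemma rewiring_increasing_v : increasing T v.
Proof. by rewrite increasingE vr (rew_lt_father rew). Qed.

Lemma rewiring_increasing_v' : increasing T' v = false.
Proof. by rewrite increasingE (rew_v' rew) ltnNge ltnW ?andbF ?(rew_lt_b rew). Qed.

Lemma rewiring_decreasing_v : decreasing T' v.
Proof. by rewrite decreasingE vr rewiring_increasing_v'. Qed.

(** Only [u] needs an argument: its father changes from [v] to the father of [v], and both are
    smaller than [u]. *)
Lemma rewiring_increasing w : w != v -> increasing T' w = increasing T w.
Proof.
rewrite !increasingE => wv; have [->|wu] := eqVneq w u.
  rewrite (rew_u rew) (rew_u' rew) (rew_lt_u rew).
  by rewrite (ltn_trans (rew_lt_father rew) (rew_lt_u rew)).
by rewrite (rew_father rew).
Qed.

Lemma rewiring_decreasing w : decreasing T' w = (w == v) || decreasing T w.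
Proof.
have [->|wv] := eqVneq w v; first exact: rewiring_decreasing_v.
by rewrite !decreasingE rewiring_increasing.
Qed.

Lemma rewiring_moved_v : moved (T, phi) v.
Proof.
rewrite /moved rewiring_increasing_v /= (rew_phi rew).
by apply/eqP => -[bv]; have := rew_lt_b rew; rewrite bv ltnn.
Qed.

Lemma rewiring_moved w : moved (T, phi) w = (w == v) || moved (T', phi') w.
Proof.
have [->|wv] := eqVneq w v; first exact: rewiring_moved_v.
by rewrite /moved /= rewiring_increasing // (rew_phi_other rew).
Qed.

Lemma rewiring_moved' w : moved (T', phi') w -> w != v.
Proof. by apply: contraTneq => ->; rewrite /moved rewiring_increasing_v'. Qed.

Lemma rewiring_card_decreasing :
  #|[set w | decreasing T' w]| = #|[set w | decreasing T w]|.+1.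
Proof.
have -> : [set w | decreasing T' w] = v |: [set w | decreasing T w].
  by apply/setP => w; rewrite !inE rewiring_decreasing.
by rewrite cardsU1 inE increasing_decreasing ?rewiring_increasing_v.
Qed.

Lemma rewiring_card_moved :
  #|[set w | moved (T, phi) w]| = #|[set w | moved (T', phi') w]|.+1.
Proof.
have -> : [set w | moved (T, phi) w] = v |: [set w | moved (T', phi') w].
  by apply/setP => w; rewrite !inE rewiring_moved.
by rewrite cardsU1 inE /moved rewiring_increasing_v'.
Qed.

(** Hooks survive by [fconnect_cut], since [v] itself leaves the domain of [phi]. By maximality the
    remaining moved vertices are below [v]. As [v] becomes the smallest decreasing vertex, the ways
    from them to the root descend through increasing vertices, and condition (3) holds for [v]. *)
Lemma labelled_rewiring : labelled T phi -> is_tree T' ->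
    (forall w, moved (T, phi) w -> val w <= val v) ->
  labelled T' phi' /\ (forall w, decreasing T' w -> val v <= val w).
Proof.
move=> lab T'_tree vmax.
have vmin w : decreasing T' w -> val v <= val w.
  rewrite rewiring_decreasing => /orP[/eqP->//|dw].
  exact: ltnW (lab_decreasing lab dw rewiring_moved_v).
have moved_lt w : moved (T', phi') w -> moved (T, phi) w /\ val w < val v.
  move=> mw; have mw' : moved (T, phi) w by rewrite rewiring_moved mw orbT.
  split=> //; rewrite ltn_neqAle vmax // andbT.
  by rewrite (inj_eq val_inj) rewiring_moved'.
have [_ cut] := fconnect_cut (father_rooted (lab_tree lab)) vr ur (rew_father rew)
  (rew_u rew) (rew_conn rew) (rew_u' rew) (rew_v' rew).
split=> //; split=> //.
- move=> w; have [->|wv] := eqVneq w v.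
    by rewrite (rew_phi' rew) rewiring_increasing_v'.
  by rewrite (rew_phi_other rew) // (lab_dom lab) rewiring_increasing.
- move=> w c; have [->|wv] := eqVneq w v; first by rewrite (rew_phi' rew).
  by rewrite (rew_phi_other rew) // => /(lab_hook lab)[/cut->].
- move=> w x /moved_lt[_ wv] wx xr.
  have inc y : val y < val v -> y != r -> increasing T' y.
    move=> yv yr; apply: contraLR yv; rewrite -leqNgt => yNinc; apply: vmin.
    by rewrite decreasingE yr.
  apply: (inc _ _ xr); apply: (@fconnect_closed _ _ (fun y => val y < val v)) wx => // y yv.
  have [->|yr] := eqVneq y r; last exact: ltn_trans (increasing_father (inc y yv yr)) yv.
  by rewrite father_root //; apply: leq_ltn_trans (root_le (father T v)) (rew_lt_father rew).
move=> x w; rewrite rewiring_decreasing => /orP[/eqP-> /moved_lt[]//|dx /moved_lt[mw _]].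
exact: lab_decreasing mw.
Qed.

(** By minimality every non-root vertex up to [v] is increasing in [T], so ways to the root from
    moved vertices descend. A decreasing vertex of [T] is decreasing in [T'] and differs from [v],
    hence exceeds [v]. Hooks are handled by [fconnect_splice]. *)
Lemma labelled_rewiring' : labelled T' phi' -> is_tree T ->
    (forall w, decreasing T' w -> val v <= val w) ->
  labelled T phi /\ (forall w, moved (T, phi) w -> val w <= val v).
Proof.
move=> lab T_tree vmin.
have moved_lt w : moved (T', phi') w -> val w < val v.
  by move=> mw; apply: lab_decreasing lab _ _ rewiring_decreasing_v mw.
have inc x : val x < val v -> x != r -> increasing T x.
  move=> xv xr; apply: contraLR xv; rewrite -leqNgt => xNinc; apply: vmin.
  by rewrite rewiring_decreasing decreasingE xr xNinc orbT.
have vmax w : moved (T, phi) w -> val w <= val v.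
  by rewrite rewiring_moved => /orP[/eqP->//|/moved_lt/ltnW].
have [buT splice] := fconnect_splice (father_rooted (lab_tree lab)) vr ur
  (fun w wu wv => esym (rew_father rew wu wv))
  (rew_v' rew) (rew_conn' rew) (rew_u rew) (esym (rew_u' rew)).
split=> //; split=> //.
- move=> w; have [->|wv] := eqVneq w v.
    by rewrite (rew_phi rew) rewiring_increasing_v.
  by rewrite -(rew_phi_other rew) // (lab_dom lab) rewiring_increasing.
- move=> w c; have [->|wv] := eqVneq w v.
    rewrite (rew_phi rew) => -[<-]; split; last exact: ltnW (rew_lt_b rew).
    by apply: connect_trans buT _; rewrite -(rew_u rew) fconnect1.
  rewrite -(rew_phi_other rew) // => phiw; have [cw ->] := lab_hook lab phiw.
  split=> //; have [->//|neq] := eqVneq c w.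
  have mw : moved (T', phi') w.
    rewrite /moved -(lab_dom lab) phiw /=.
    by apply: contra neq => /eqP[->].
  apply: splice cw _; apply/negP => wu.
  (* By condition (2) in [T'] labels never grow on the way from the moved vertex [w] to the root, so
     meeting [u] would give [u <= w < v < u]. *)
  suff : val u <= val w.
    by rewrite leqNgt (ltn_trans (moved_lt _ mw) (rew_lt_u rew)).
  suff [] : fconnect (father T') w u /\ val u <= val w by [].
  apply: (@fconnect_closed _ (father T')
    (fun x => fconnect (father T') w x /\ val x <= val w)) wu => //.
  move=> x [wx xw]; split; first exact: connect_trans wx (fconnect1 _ _).
  have [->|xr] := eqVneq x r; first by rewrite father_root ?root_le ?(lab_tree lab).
  apply: leq_trans xw; apply/ltnW/increasing_father.
  exact: lab_moved mw wx xr.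
- move=> w x mw wx xr.
  have inc_le y : val y <= val v -> y != r -> increasing T y.
    rewrite leq_eqVlt => /orP[/eqP/val_inj-> _|]; last exact: inc.
    exact: rewiring_increasing_v.
  apply: (inc_le _ _ xr).
  apply: (@fconnect_closed _ _ (fun y => val y <= val v)) wx; last exact: vmax.
  move=> y yv; have [->|yr] := eqVneq y r; first by rewrite father_root ?root_le.
  exact: leq_trans (ltnW (increasing_father (inc_le y yv yr))) yv.
move=> x w dx; have dx' : decreasing T' x by rewrite rewiring_decreasing dx orbT.
rewrite rewiring_moved => /orP[/eqP->|mw]; last exact: lab_decreasing dx' mw.
rewrite ltn_neqAle vmin // andbT (inj_eq val_inj).
by apply: contraTneq dx => <-; apply/increasing_decreasing/rewiring_increasing_v.
Qed.

End Rewiring.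

(** * Invariance of the weight *)

Definition factor T phi w : {cmonom indet A} :=
  if increasing T w then mmul (x_ (father T w)) (y_ w (odflt w (phi w)))
  else mmul (x_ w) (y_ w (father T w)).

(** The two products are merged because [v] passes from the increasing to the decreasing
    vertices. *)
Lemma weightE T phi :
  weight (T, phi) = \big[mmul/mone]_(w | w != r) factor T phi w.
Proof.
rewrite /weight [RHS](bigID (increasing T)) /=; congr mmul.
  apply: eq_big => [w|w incw]; last by rewrite /factor incw.
  by rewrite increasingE; case: (w == r).
apply: eq_big => [w|w]; rewrite decreasingE //.
by rewrite /factor; case/andP=> _ /negPf->.
Qed.

Lemma weight_split T phi v u : v != r -> u != r -> u != v ->
  weight (T, phi) = mmul (mmul (factor T phi v) (factor T phi u))
    (\big[mmul/mone]_(w | (w != r) && (w != v) && (w != u)) factor T phi w).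
Proof.
move=> vr ur uv; have urv : (u != r) && (u != v) by rewrite ur.
by rewrite weightE (bigD1 v vr) (bigD1 u urv); apply: mulmA.
Qed.

Lemma rewiring_weight T T' phi phi' v b u :
  rewiring T phi T' phi' v b u -> weight (T, phi) = weight (T', phi').
Proof.
move=> rew; have vr := lt_neq_root (rew_lt_father rew).
have ur := lt_neq_root (rew_lt_u rew).
have uv : u != v by apply/eqP => uv; have := rew_lt_u rew; rewrite uv ltnn.
have incu : increasing T u by rewrite increasingE ur (rew_u rew) (rew_lt_u rew).
apply: etrans (weight_split T phi vr ur uv) _.
apply: etrans _ (esym (weight_split T' phi' vr ur uv)).
refine (f_equal2 _ _ _); last first.
  apply: eq_bigr => w /andP[/andP[_ wv] wu].
  rewrite /factor (rewiring_increasing rew wv) (rew_father rew wu wv).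
  by rewrite (rew_phi_other rew wv).
rewrite /factor (rewiring_increasing_v rew) (rewiring_increasing_v' rew).
rewrite (rewiring_increasing rew uv) incu (rew_phi rew) (rew_phi_other rew uv).
rewrite (rew_u rew) (rew_u' rew) (rew_v' rew).
exact: mulm_swap.
Qed.

(** The graph of the bijection. The first extremality condition determines [v] from [p], the second
    determines it from [q]. *)
Definition extremal_rewiring (p q : tree_fun A) : Prop := exists v b u,
  [/\ rewiring p.1 p.2 q.1 q.2 v b u, forall w, moved p w -> val w <= val v
    & forall w, decreasing q.1 w -> val v <= val w].

(** * Existence of extremal rewirings in both directions *)

Lemma rewiring_exists T phi v0 : labelled T phi -> moved (T, phi) v0 ->
  exists2 q, labelled q.1 q.2 & extremal_rewiring (T, phi) q.
Proof.
move=> lab /(arg_maxnP (fun w : V => val w))[v mv vmax].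
have rf := father_rooted (lab_tree lab).
have incv : increasing T v by case/andP: mv.
have lt_fv := increasing_father incv; have vr := lt_neq_root lt_fv.
have [b phiv] : exists b, phi v = Some b.
  by move: (lab_dom lab v); rewrite incv; case: (phi v) => // b _; exists b.
have [bv v_le_b] := lab_hook lab phiv.
have neq : b != v by apply: contraTneq mv => bv'; rewrite /moved phiv bv' eqxx andbF.
have vb : val v < val b by rewrite ltn_neqAle v_le_b (inj_eq val_inj) eq_sym neq.
have [u bu fu] := fconnect_last bv neq.
have ur : u != r.
  by apply: contraNneq vr => ur; rewrite -fu ur; apply/eqP; case: rf.
(* If [u] were decreasing, condition (3) would give [v < u]; but [v] is the father of [u]. *)
have incu : increasing T u.
  apply: contraT => uNinc.
  have du : decreasing T u by rewrite decreasingE ur.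
  have := lab_decreasing lab du mv.
  by move: uNinc; rewrite increasingE ur fu /= => /negPf->.
have vu : val v < val u.
  by have := increasing_father incu; rewrite fu.
have uv : u != v by apply: contraTneq vu => ->; rewrite ltnn.
pose f' w := if w == v then b else if w == u then father T v else father T w.
have f'v : f' v = b by rewrite /f' eqxx.
have f'u : f' u = father T v by rewrite /f' (negPf uv) eqxx.
have f'E w : w != u -> w != v -> f' w = father T w.
  by move=> /negPf wu /negPf wv; rewrite /f' wu wv.
have [f'bu cut] := fconnect_cut rf vr ur f'E fu bu f'u f'v.
have rf' : rooted r f'.
  split=> [|w]; first by rewrite f'E 1?eq_sym //; case: rf.
  by apply: cut; rewrite 1?eq_sym //; case: rf.
have T'_tree := edges_tree rf'; have fT' := father_edges rf'.
pose phi' := [ffun w => if w == v then None else phi w].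
have rew : rewiring T phi (edges r f') phi' v b u.
  split=> //; rewrite ?fT' //.
  - by move=> w wu wv; rewrite fT' f'E.
  - by rewrite ffunE eqxx.
  - by move=> w /negPf wv; rewrite ffunE wv.
  - by rewrite (eq_fconnect fT').
have [lab' vmin] := labelled_rewiring rew lab T'_tree vmax.
by exists (edges r f', phi') => //; exists v, b, u.
Qed.

Lemma rewiring_exists' T' phi' v0 : labelled T' phi' -> decreasing T' v0 ->
  exists2 p, labelled p.1 p.2 & extremal_rewiring p (T', phi').
Proof.
move=> lab /(arg_minnP (fun w : V => val w))[v dv vmin].
have := father_rooted (lab_tree lab); set f := father T' => rf.
have /andP[vr] : (v != r) && ~~ increasing T' v by rewrite -decreasingE.
rewrite increasingE vr /= -leqNgt -/f => v_le_b.
have fvv := father_neq rf vr.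
set b := f v in v_le_b fvv.
have vb : val v < val b by rewrite ltn_neqAle v_le_b (inj_eq val_inj) eq_sym fvv.
have rv : val r < val v.
  by rewrite ltn_neqAle root_le (inj_eq val_inj) eq_sym vr.
have bNv : ~~ (val b < val v) by rewrite -leqNgt.
(* The way from [b], which is above [v], to the root, which is below [v], has to drop below [v]; [u]
   is the vertex just before a drop. *)
have [u [bu]] := fconnect_crossing (P := fun w => val w < val v) (proj2 rf b) bNv rv.
rewrite -leqNgt => v_le_u fuv.
(* Otherwise [v] and its father [b] would be ancestors of each other. *)
have uv : u != v.
  apply: contraTneq bu => ->; apply: contra fvv => bv.
  by rewrite (fconnect_anti rf bv (fconnect1 f v)).
have vu : val v < val u by rewrite ltn_neqAle v_le_u (inj_eq val_inj) eq_sym uv.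
have ur : u != r := lt_neq_root vu.
pose g w := if w == v then f u else if w == u then v else f w.
have gv : g v = f u by rewrite /g eqxx.
have gu : g u = v by rewrite /g (negPf uv) eqxx.
have gE w : w != u -> w != v -> g w = f w.
  by move=> /negPf wu /negPf wv; rewrite /g wu wv.
have [gbu splice] := fconnect_splice rf vr ur gE (erefl b) bu gu gv.
have rg : rooted r g.
  split=> [|w]; first by rewrite gE 1?eq_sym //; case: rf.
  apply: splice; first by case: rf.
  by apply: contra ur => /(fconnect_root rf)->.
have T_tree := edges_tree rg; have fT := father_edges rg.
pose phi := [ffun w => if w == v then Some b else phi' w].
have rew : rewiring (edges r g) phi T' phi' v b u.
  split=> //; rewrite ?fT ?gv ?gu //.
  - by move=> w wu wv; rewrite fT gE.
  - by rewrite ffunE eqxx.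
  (* Being decreasing, [v] lies outside the domain of [phi']. *)
  - move: (lab_dom lab v) (increasing_decreasing (T := T') (w := v)).
    by case: (phi' v) => // c <- /(_ isT); rewrite dv.
  - by move=> w /negPf wv; rewrite ffunE wv.
  - by rewrite (eq_fconnect fT).
have [lab' vmax] := labelled_rewiring' rew lab T_tree vmin.
by exists (edges r g, phi) => //; exists v, b, u.
Qed.

(** * Uniqueness of extremal rewirings in both directions *)

Lemma labelled_eq T1 phi1 T2 phi2 : is_tree T1 -> is_tree T2 ->
  father T1 =1 father T2 -> phi1 =1 phi2 -> (T1, phi1) = (T2, phi2).
Proof.
move=> T1_tree T2_tree fE phiE; congr pair; last exact/ffunP.
rewrite -(edges_father T1_tree) -(edges_father T2_tree).
by apply: eq_imset => w; rewrite fE.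
Qed.

(** From [p] one reads off [v] as the largest moved vertex, [b] as its value under [phi], and [u] as
    the only child of [v] on the way from [b]. *)
Lemma extremal_rewiring_functional p q1 q2 :
  is_tree p.1 -> is_tree q1.1 -> is_tree q2.1 ->
  extremal_rewiring p q1 -> extremal_rewiring p q2 -> q1 = q2.
Proof.
case: p q1 q2 => T phi [T1 phi1] [T2 phi2] /= T_tree T1_tree T2_tree.
case=> v [b [u [/= rew1 vmax1 _]]] [v' [b' [u' [/= rew2 vmax2 _]]]].
have ev : v' = v.
  apply/val_inj/eqP; rewrite eqn_leq vmax1 ?vmax2 //.
    exact: rewiring_moved_v rew1.
  exact: rewiring_moved_v rew2.
subst v'; have [eb] : Some b' = Some b by rewrite -(rew_phi rew1) (rew_phi rew2).
subst b'; have rT := father_rooted T_tree.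
(* Were [x] and [y] distinct, their common father [v] would have [y] as an ancestor while being the
   father of [y], so [y] would equal [v]. *)
have child_unique x y : father T x = v -> father T y = v -> val v < val y ->
    fconnect (father T) x y -> x = y.
  move=> fx fy vy; rewrite fconnect_eqVf fx => /predU1P[//|vy'].
  have yv : fconnect (father T) y v by rewrite -fy fconnect1.
  by rewrite (fconnect_anti rT yv vy') ltnn in vy.
have eu : u = u'.
  case/orP: (fconnect_comparable (rew_conn rew1) (rew_conn rew2)).
    by apply: child_unique; rewrite ?(rew_u rew1) ?(rew_u rew2) ?(rew_lt_u rew2).
  move=> H; apply/esym; move: H.
  by apply: child_unique; rewrite ?(rew_u rew1) ?(rew_u rew2) ?(rew_lt_u rew1).
subst u'; apply: labelled_eq => // w.
  have [->|wv] := eqVneq w v; first by rewrite (rew_v' rew1) (rew_v' rew2).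
  have [->|wu] := eqVneq w u; first by rewrite (rew_u' rew1) (rew_u' rew2).
  by rewrite (rew_father rew1) ?(rew_father rew2).
have [->|wv] := eqVneq w v; first by rewrite (rew_phi' rew1) (rew_phi' rew2).
by rewrite (rew_phi_other rew1) ?(rew_phi_other rew2).
Qed.

(** From [q] one reads off [v] as the smallest decreasing vertex and [b] as its father; it remains
    to recover [u]. *)
Lemma extremal_rewiring_injective p1 p2 q :
  is_tree p1.1 -> is_tree p2.1 -> is_tree q.1 ->
  extremal_rewiring p1 q -> extremal_rewiring p2 q -> p1 = p2.
Proof.
case: q p1 p2 => T' phi' [T1 phi1] [T2 phi2] /= T1_tree T2_tree T'_tree.
case=> v [b [u [/= rew1 _ vmin1]]] [v' [b' [u' [/= rew2 _ vmin2]]]].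
have ev : v' = v.
  apply/val_inj/eqP; rewrite eqn_leq vmin1 ?vmin2 //.
    exact: rewiring_decreasing_v rew1.
  exact: rewiring_decreasing_v rew2.
subst v'; have eb : b' = b by rewrite -(rew_v' rew1) (rew_v' rew2).
subst b'.
(* From the first vertex below v on, the way to the root stays below v, so u
   is the last vertex above v on the way from b to the root. *)
have below x y : val (father T' x) < val v -> val v < val y ->
    fconnect (father T') x y -> x = y.
  move=> fxv vy; rewrite fconnect_eqVf => /predU1P[//|fxy].
  suff yv : val y < val v by have := ltn_trans yv vy; rewrite ltnn.
  apply: (@fconnect_closed _ _ (fun z => val z < val v)) fxv fxy => z zv.
  have [->|zr] := eqVneq z r.
    rewrite father_root //; apply: leq_ltn_trans (root_le (father T1 v)) _.
    exact: rew_lt_father rew1.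
  apply: ltn_trans (zv); apply: increasing_father.
  apply: contraLR zv; rewrite -leqNgt => zNinc; apply: vmin1.
  by rewrite decreasingE zr.
have fu T0 phi0 u0 : rewiring T0 phi0 T' phi' v b u0 -> val (father T' u0) < val v.
  by move=> rew; rewrite (rew_u' rew) (rew_lt_father rew).
have eu : u = u'.
  case/orP: (fconnect_comparable (rew_conn' rew1) (rew_conn' rew2)).
    by apply: below (fu _ _ _ rew1) (rew_lt_u rew2).
  by move/(below _ _ (fu _ _ _ rew2) (rew_lt_u rew1)).
subst u'; apply: labelled_eq => // w.
  have [->|wv] := eqVneq w v; first by rewrite -(rew_u' rew1) (rew_u' rew2).
  have [->|wu] := eqVneq w u; first by rewrite (rew_u rew1) (rew_u rew2).
  by rewrite -(rew_father rew1) ?(rew_father rew2).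
have [->|wv] := eqVneq w v; first by rewrite (rew_phi rew1) (rew_phi rew2).
by rewrite -(rew_phi_other rew1) ?(rew_phi_other rew2).
Qed.

(** * The bijection between the two classes *)

Lemma extremal_rewiring_cards p q : extremal_rewiring p q ->
  #|[set w | decreasing q.1 w]| = #|[set w | decreasing p.1 w]|.+1 /\
  #|[set w | moved p w]| = #|[set w | moved q w]|.+1.
Proof.
case: p q => T phi [T' phi'] [v [b [u [rew _ _]]]].
by rewrite (rewiring_card_decreasing rew) (rewiring_card_moved rew).
Qed.

Lemma extremal_rewiring_weight p q : extremal_rewiring p q -> weight p = weight q.
Proof.
case: p q => T phi [T' phi'] [v [b [u [rew _ _]]]].
exact: (rewiring_weight rew).
Qed.

Lemma calL_rewiring_exists i j p : p \in calL A i j.+1 ->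
  exists2 q, q \in calL A i.+1 j & extremal_rewiring p q.
Proof.
case: p => T phi /calLP[lab di mj].
have [v mv] : exists v, v \in [set v | moved (T, phi) v].
  by apply/set0Pn; rewrite -card_gt0 mj.
rewrite inE in mv; have [q labq pq] := rewiring_exists lab mv.
exists q => //; case: (q) labq pq => T' phi' labq pq.
have [eqd /eqP] := extremal_rewiring_cards pq.
by rewrite mj eqSS => /eqP eqm; apply/calLP; rewrite eqd di -eqm.
Qed.

Lemma calL_rewiring_exists' i j q : q \in calL A i.+1 j ->
  exists2 p, p \in calL A i j.+1 & extremal_rewiring p q.
Proof.
case: q => T' phi' /calLP[lab di mj].
have [v dv] : exists v, v \in [set v | decreasing T' v].
  by apply/set0Pn; rewrite -card_gt0 di.
rewrite inE in dv; have [p labp pq] := rewiring_exists' lab dv.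
exists p => //; case: (p) labp pq => T phi labp pq.
have [/eqP + eqm] := extremal_rewiring_cards pq.
by rewrite di eqSS => /eqP eqd; apply/calLP; rewrite eqm mj -eqd.
Qed.

Lemma calL_tree i j p : p \in calL A i j -> is_tree p.1.
Proof. by case: p => T phi /calLP[[]]. Qed.

End LabelledTrees.

Lemma root_exists (A : {fset nat}) :
  A != fset0 -> exists r : fset_sub_type A, is_root r.
Proof.
case/fset0Pn => a aA; pose a0 : fset_sub_type A := [` aA]%fset.
case: (@arg_minnP _ a0 predT (fun w : fset_sub_type A => val w)) => // r _ rmin.
by exists r; apply/forallP => w; apply: rmin.
Qed.

Theorem theorem2p1 (A : {fset nat}) (i j : nat)
  (A_neq0 : A != fset0) (A_pos : forall a : nat, a \in A -> 0 < a)
  (j_ge1 : 1 <= j) :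
  exists f : {p : tree_fun A | p \in calL A i j} ->
             {p : tree_fun A | p \in calL A i.+1 j.-1},
    bijective f /\ (forall p, weight (val p) = weight (val (f p))).
Proof.
have [r r_root] := root_exists A_neq0.
case: j j_ge1 => // j _ /=.
have [f fP] : exists f : {p | p \in calL A i j.+1} -> {p | p \in calL A i.+1 j},
    forall p, extremal_rewiring (val p) (val (f p)).
  (* The domain is finite, so a partner can be chosen for all its elements at once without an axiom
     of choice. *)
  apply: (fin_all_exists (P := fun p q => extremal_rewiring (val p) (val q))).
  move=> [p pL].
  by have [q qL pq] := calL_rewiring_exists r_root pL; exists (exist _ q qL).
have [g gP] : exists g : {p | p \in calL A i.+1 j} -> {p | p \in calL A i j.+1},
    forall q, extremal_rewiring (val (g q)) (val q).
  apply: (fin_all_exists (P := fun q p => extremal_rewiring (val p) (val q))).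
  move=> [q qL].
  by have [p pL pq] := calL_rewiring_exists' r_root qL; exists (exist _ p pL).
have tree k l (p : {p | p \in calL A k l}) : is_tree (val p).1.
  by case: p => p pL; apply: (calL_tree r_root pL).
exists f; split.
  (* Both [g (f p)] and [p] are related to [f p]; dually, [g p] is related to both [f (g p)] and
     [p]. *)
  exists g => p; apply: val_inj.
    apply: (extremal_rewiring_injective r_root _ _ _ (gP (f p)) (fP p));
    exact: tree.
  apply: (extremal_rewiring_functional r_root _ _ _ (fP (g p)) (gP p));
  exact: tree.
move=> p; exact: (extremal_rewiring_weight r_root (fP p)).
Qed.
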